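(* There are positive constants $c$ and $n_0$ such that for every $n\geq n_0$ there exists a tree $T_n$ with $n$ vertices and maximum degree $\Delta(T_n)<\left(\frac12-c\right)n$ such that Client has a winning strategy in the game $\mathrm{WC}(n,T_n)$.
   Context: The unbiased Waiter-Client game $\mathrm{WC}(n,T_n)$ is played on the edge set of the complete graph $K_n$. In each round Waiter offers Client two previously unclaimed edges; Client chooses one of them, which he keeps (colored red), and the other goes to Waiter (colored blue). If in the final round only one unclaimed edge remains, it goes to Waiter. Waiter wins if at the end Client's (red) graph contains a copy of the tree $T_n$; otherwise Client wins. *)

(* Defs.v *)
From HB Require Import structures.
From mathcomp Require Import all_boot all_order all_algebra.
From mathcomp Require Import reals.
Set Implicit Arguments. Unset Strict Implicit. Unset Printing Implicit Defensive.
Import Order.TTheory GRing.Theory Num.Theory.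

Definition Kn_edges (n : nat) : {set {set 'I_n}} :=
  [set e : {set 'I_n} | #|e| == 2].

Definition edge_set (n : nat) (T : rel 'I_n) : {set {set 'I_n}} :=
  [set [set p.1; p.2] | p in [set p : 'I_n * 'I_n | T p.1 p.2]].

Definition is_tree (n : nat) (T : rel 'I_n) : Prop :=
  symmetric T /\ irreflexive T /\ (forall x y, connect T x y) /\
  #|edge_set T| = n.-1.

Definition degree (n : nat) (T : rel 'I_n) (v : 'I_n) : nat :=
  #|[set w | T v w]|.

Definition max_degree (n : nat) (T : rel 'I_n) : nat :=
  \max_(v : 'I_n) degree T v.

Definition contains_copy (n : nat) (T : rel 'I_n) (R : {set {set 'I_n}}) : bool :=
  [exists f : {ffun 'I_n -> 'I_n},
     injectiveb f && [forall x, forall y, T x y ==> ([set f x; f y] \in R)]].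

(* A (positional) Client strategy: given Client's red edges R, Waiter's blue
   edges B and the offered ordered pair (e1, e2), returns true if Client keeps
   e1 (and e2 goes to Waiter), false if Client keeps e2. *)
Definition client_strategy (n : nat) :=
  {set {set 'I_n}} -> {set {set 'I_n}} -> {set 'I_n} -> {set 'I_n} -> bool.

(* [strategy_wins T s k R B]: playing s from position (R, B), Client wins
   against every possible sequence of Waiter offers.  When at most one
   unclaimed edge remains, the game ends (a last edge goes to Waiter) and
   Client wins iff his red graph contains no copy of T.  k is fuel
   (number of rounds still allowed); it is chosen large enough below. *)
Fixpoint strategy_wins (n : nat) (T : rel 'I_n) (s : client_strategy n)
    (k : nat) (R B : {set {set 'I_n}}) : bool :=
  match k with
  | 0 => ~~ contains_copy T R
  | k'.+1 =>
    let U := Kn_edges n :\: (R :|: B) in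
    if #|U| <= 1 then ~~ contains_copy T R
    else [forall e1, forall e2,
            [&& e1 \in U, e2 \in U & e1 != e2] ==>
            (if s R B e1 e2
             then strategy_wins T s k' (e1 |: R) (e2 |: B)
             else strategy_wins T s k' (e2 |: R) (e1 |: B))]
  end.

(* Client has a winning strategy in WC(n, T): the fuel #|E(K_n)|.+1
   exceeds the number of rounds, so the fuel-0 case is never reached. *)
Definition client_wins (n : nat) (T : rel 'I_n) : Prop :=
  exists s : client_strategy n, strategy_wins T s (#|Kn_edges n|.+1) set0 set0.

(* Main.v *)
Require Import Defs.
From HB Require Import structures.
From mathcomp Require Import all_boot all_order all_algebra.
From mathcomp Require Import reals.
From mathcomp Require Import zify lra.
Import Order.TTheory GRing.Theory Num.Theory.
Local Open Scope ring_scope.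

Set Implicit Arguments.
Unset Strict Implicit.
Unset Printing Implicit Defensive.

(** The tree has two hubs, each with slightly fewer than n/2 leaves, and a third
    hub carrying the few remaining vertices.  In a red copy the images u, v of
    the two big hubs have disjoint red neighbourhoods of size almost n/2 each.
    If Client coloured by fair coins, almost every x would then have to be
    offered through the pair {xu, xv}, and the degrees of u and v would stay
    balanced.  Client therefore tosses a slightly unfair coin favouring, among
    xu and xv, the edge to the smaller of u and v: pairing many x now pushes
    the degree of the larger one below n/2, and not pairing them leaves many x
    with both edges blue.  Both effects are measured by one multiplicative
    weight per pair u < v, a product over the centres x, whose mean never
    increases.  Client derandomizes the coin by keeping the sum of these
    weights nonincreasing, hence at most n^2, while a copy of the tree would
    make one of them exponentially large. *)

(** * Trees on an initial segment of the naturals given by a parent function *)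

Section ParentTree.
Local Open Scope nat_scope.

Lemma card_ord_itv n lo hi : hi <= n ->
  #|[set i : 'I_n | lo <= i < hi]| = hi - lo.
Proof.
move=> le_hi; rewrite -sum1_card (eq_bigl (fun i : 'I_n => lo <= i < hi)); last first.
  by move=> i; rewrite inE.
rewrite -(big_mkord (fun i => lo <= i < hi) (fun=> 1)).
rewrite -(big_nat_widen 0 hi n (fun i => lo <= i)) //.
case: (leqP lo hi) => [le_lo|lt_hi].
  rewrite -(big_nat_widenl lo 0 hi predT) //= big_const_nat iter_addn_0 mul1n //.
rewrite big_nat_cond big_pred0 => [|i]; lia.
Qed.

Variables (n : nat) (p : nat -> nat).
Hypothesis p_lt : forall i, 0 < i -> p i < i.

Definition parent_rel : rel 'I_n :=
  fun x y => (0 < x) && (y == p x :> nat) || (0 < y) && (x == p y :> nat).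

(** Iterating [p] leads every vertex down to 0, which gives connectedness. Each nonzero vertex
    contributes the edge to its parent, and that edge determines it as the larger endpoint, so there
    are [n.-1] edges. *)
Lemma parent_rel_tree : 0 < n -> is_tree parent_rel.
Proof.
move=> n_gt0.
have sym : symmetric parent_rel by move=> x y; rewrite /parent_rel orbC.
(* The default [i] can only occur at the root, since [p i < i < n] elsewhere. *)
pose P (i : 'I_n) : 'I_n := insubd i (p i).
have P_val (i : 'I_n) : 0 < i -> P i = p i :> nat.
  by move=> i_gt0; rewrite val_insubd (ltn_trans (p_lt i_gt0)).
pose r : 'I_n := Ordinal n_gt0.
split=> //; split; last split.
- by move=> x; rewrite /parent_rel orbb; apply/negP => /andP[/p_lt + /eqP]; lia.
- have to_r x : connect parent_rel x r.
    move: {2}(nat_of_ord x) (leqnn (nat_of_ord x)) => m; elim: m x => [|m IHm] x le_x.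
      by have -> : x = r; [apply/val_inj => /=; lia | exact: connect0].
    have [x0|x_gt0] := posnP x; first by apply: IHm; rewrite x0.
    apply: (@connect_trans _ _ (P x)).
      by apply: connect1; rewrite /parent_rel x_gt0 P_val ?eqxx.
    by apply: IHm; rewrite P_val //; have := p_lt x_gt0; lia.
  move=> x y; apply: connect_trans (to_r x) _.
  by rewrite (sym_connect_sym sym).
- have -> : edge_set parent_rel = [set [set i; P i] | i in [set i : 'I_n | 1 <= i < n]].
    apply/setP=> e; apply/imsetP/imsetP => -[].
      move=> [x y]; rewrite inE /parent_rel /= => /orP[]/andP[z_gt0 /eqP zE] ->.
        exists x; first by rewrite inE z_gt0 ltn_ord.
        by congr [set _; _]; apply: val_inj; rewrite /= zE P_val.
      exists y; first by rewrite inE z_gt0 ltn_ord.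
      by rewrite setUC; congr [set _; _]; apply: val_inj; rewrite /= zE P_val.
    move=> x; rewrite inE => /andP[x_gt0 _] ->; exists (x, P x) => //.
    by rewrite inE /parent_rel /= x_gt0 P_val ?eqxx.
  rewrite card_in_imset ?card_ord_itv ?subn1 // => i j.
  rewrite !inE => /andP[i_gt0 _] /andP[j_gt0 _] eq_ij; apply: val_inj => /=.
  have := set21 i (P i); rewrite eq_ij => /set2P[-> //|iE].
  have := set21 j (P j); rewrite -eq_ij => /set2P[-> //|jE].
  have := p_lt i_gt0; have := p_lt j_gt0.
  by rewrite -!P_val // -iE -jE; lia.
Qed.

Lemma degree_parent_rel (v c : 'I_n) lo hi : hi <= n ->
  (forall w, parent_rel v w -> (w == c) || (lo <= w < hi)) ->
  degree parent_rel v <= (hi - lo).+1.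
Proof.
move=> le_hi nbr; rewrite -(card_ord_itv lo le_hi).
have /subset_leq_card/leq_trans : [set w | parent_rel v w] \subset
    c |: [set i : 'I_n | lo <= i < hi].
  by apply/subsetP=> w; rewrite !inE => /nbr.
by apply; rewrite cardsU1 -add1n leq_add2r leq_b1.
Qed.

End ParentTree.

(** * Numerical inequalities for the weights *)

Section Potential.
Variable K : realFieldType.

(* With t = 1/200 and an offset of 1/2000 for completed pairs, these are
   first-order values 1 + t f whose average drops by about t each time one
   edge gets coloured by a nearly fair coin.  The exception is a round that
   offers both edges at once, with outcomes 1961/2000 and 2041/2000: only the
   21:19 bias makes its average decrease, yet the product of the two outcomes
   exceeds 1, which is what a copy of the tree exploits.  [Some true] is red,
   [None] is unclaimed. *)
Definition weight (c d : option bool) : K :=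
  match c, d with
  | None, None => 1
  | Some true, None => 201 / 200
  | Some false, None => 197 / 200
  | None, Some true => 205 / 200
  | None, Some false => 193 / 200
  | Some true, Some false => 1961 / 2000
  | _, Some true => 2041 / 2000
  | Some false, Some false => 188 / 200
  end.

(* [o] is the colour of the edge in play and [b] tells whether that edge comes
   first. *)
Definition slot_weight (b : bool) (c o : option bool) : K :=
  if b then weight o c else weight c o.

Lemma weight_gt0 c d : 0 < weight c d.
Proof. by case: c d => [[]|] [[]|] /=; lra. Qed.

(** Colouring one edge lowers the fair average by at least 9/2000, whereas the bias shifts it by at
    most 3/2000, so either colour may be the favoured one. *)
Lemma slot_weight_step b c s :
  21 * slot_weight b c (Some s) + 19 * slot_weight b c (Some (~~ s))
    <= 40 * slot_weight b c None.
Proof. by rewrite /slot_weight; case: b c s => [] [[]|] [] /=; lra. Qed.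

(** Red never weighs less than blue in a slot, so the two factors, coloured oppositely, are
    negatively correlated: the mean of the product is at most the product of the means, and
    [slot_weight_step] bounds each mean. *)
Lemma slot_weight_step2 b c b' c' :
  21 * (slot_weight b c (Some true) * slot_weight b' c' (Some false)) +
  19 * (slot_weight b c (Some false) * slot_weight b' c' (Some true))
    <= 40 * (slot_weight b c None * slot_weight b' c' None).
Proof.
by rewrite /slot_weight; case: b c b' c' => [] [[]|] [] [[]|] /=; lra.
Qed.

Lemma weight_pair_step :
  21 * weight (Some true) (Some false) + 19 * weight (Some false) (Some true)
    <= 40 * weight None None.
Proof. by rewrite /=; lra. Qed.
End Potential.

(** * The effect of one round on the weight of a pair *)

Section PairPotential.
Variables (K : realFieldType) (n : nat).
Implicit Types (col : {set 'I_n} -> option bool) (e : {set 'I_n}) (u v x : 'I_n).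

Definition local_weight col u v x : K :=
  weight K (col [set x; u]) (col [set x; v]).

Definition pair_potential col u v : K :=
  \prod_(x | x \notin [set u; v]) local_weight col u v x.

Lemma pair_potential_gt0 col u v : 0 < pair_potential col u v.
Proof. by apply: prodr_gt0 => x _; exact: weight_gt0. Qed.

Definition recolor col e1 e2 : {set 'I_n} -> option bool :=
  fun e => if e == e1 then Some true else if e == e2 then Some false else col e.

Definition touches e u v x : bool := (e == [set x; u]) || (e == [set x; v]).

(** An edge thus determines the centre it touches, so a round changes at most two factors of the
    product. *)
Lemma touches_setD e u v x :
  x \notin [set u; v] -> touches e u v x -> e :\: [set u; v] = [set x].
Proof.
rewrite !inE negb_or => /andP[/negPf xu /negPf xv].
case/orP=> /eqP->; apply/setP=> y; rewrite !inE.
  by have [->|_] := eqVneq y x; rewrite ?xu ?xv //=; case: (y == u); rewrite ?andbF.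
by have [->|_] := eqVneq y x; rewrite ?xu ?xv //=; case: (y == v); rewrite ?andbF ?orbT.
Qed.

Lemma local_weight_untouched col col' e1 e2 u v x :
  (forall e, e != e1 -> e != e2 -> col' e = col e) ->
  ~~ touches e1 u v x -> ~~ touches e2 u v x ->
  local_weight col' u v x = local_weight col u v x.
Proof.
move=> eq_col; rewrite !negb_or => /andP[u1 v1] /andP[u2 v2].
by rewrite /local_weight !eq_col // eq_sym.
Qed.

(** [b] and [c] are chosen before [col'], so a single slot describes the weight before the round and
    after either outcome. *)
Lemma local_weight_touched col e1 e2 u v x :
  u != v -> x \notin [set u; v] ->
  touches e1 u v x -> ~~ touches e2 u v x ->
  exists b c, forall col', (forall e, e != e1 -> e != e2 -> col' e = col e) ->
    local_weight col' u v x = slot_weight K b c (col' e1).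
Proof.
rewrite !inE negb_or => uv /andP[xu xv].
have uvE : [set x; u] != [set x; v].
  apply: contraNneq xu => eq_uv.
  have := set22 x u; rewrite eq_uv !inE eq_sym => /orP[//|uv'].
  by rewrite uv' in uv.
move=> te1; rewrite negb_or => /andP[u2 v2]; case/orP: te1 => /eqP e1E.
  exists true, (col [set x; v]) => col' eq_col.
  by rewrite /local_weight -(eq_col [set x; v]) ?e1E // eq_sym.
exists false, (col [set x; u]) => col' eq_col.
by rewrite /local_weight -(eq_col [set x; u]) ?e1E // eq_sym.
Qed.

Lemma recolorL col e1 e2 : recolor col e1 e2 e1 = Some true.
Proof. by rewrite /recolor eqxx. Qed.

Lemma recolorR col e1 e2 : e1 != e2 -> recolor col e1 e2 e2 = Some false.
Proof. by rewrite /recolor eq_sym => /negPf->; rewrite eqxx. Qed.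

Lemma recolor_neq col e1 e2 e : e != e1 -> e != e2 -> recolor col e1 e2 e = col e.
Proof. by rewrite /recolor => /negPf-> /negPf->. Qed.

(* The coin favours the edge with the smaller sum of endpoints, so that among
   the edges [x u] and [x v] it favours the smaller of [u] and [v]; this is
   needed only when both edges of one centre are offered together. *)
Lemma pair_potential_step col e1 e2 u v :
  (u < v)%N -> e1 != e2 -> col e1 = None -> col e2 = None ->
  (\sum_(i in e1) i <= \sum_(i in e2) i)%N ->
  21 * pair_potential (recolor col e1 e2) u v +
  19 * pair_potential (recolor col e2 e1) u v <= 40 * pair_potential col u v.
Proof.
move=> lt_uv e12 c1 c2 le_e.
have uv : u != v by rewrite neq_ltn lt_uv.
set P := fun x => x \notin [set u; v].
set col1 := recolor col e1 e2; set col2 := recolor col e2 e1.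
have eq1 e : e != e1 -> e != e2 -> col1 e = col e by exact: recolor_neq.
have eq2 e : e != e1 -> e != e2 -> col2 e = col e.
  by move=> ? ?; exact: recolor_neq.
have eq0 e : e != e1 -> e != e2 -> col e = col e by [].
have col11 : col1 e1 = Some true by exact: recolorL.
have col12 : col1 e2 = Some false by exact: recolorR.
have col22 : col2 e2 = Some true by exact: recolorL.
have col21 : col2 e1 = Some false by rewrite /col2 recolorR // eq_sym.
have swap col' : (forall e, e != e1 -> e != e2 -> col' e = col e) ->
  forall e, e != e2 -> e != e1 -> col' e = col e by move=> h e ? ?; apply: h.
have uniq e x y : P x -> P y -> touches e u v x -> touches e u v y -> x = y.
  move=> Px Py tx ty; apply/set1P; rewrite -(touches_setD Py ty).
  by rewrite (touches_setD Px tx) set11.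
pose prodC (Q : pred 'I_n) := \prod_(x | P x && Q x) local_weight col u v x.
have prodC_gt0 Q : 0 < prodC Q by apply: prodr_gt0 => x _; exact: weight_gt0.
have scale (x y z p : K) : 0 < p -> 21 * x + 19 * y <= 40 * z ->
    21 * (x * p) + 19 * (y * p) <= 40 * (z * p).
  by move=> p_gt0 le_z; rewrite !(mulrA _ _ p) -mulrDl ler_pM2r.
have t1P := @pickP _ (fun x => P x && touches e1 u v x).
have t2P := @pickP _ (fun x => P x && touches e2 u v x).
have split1 y col' : (forall e, e != e1 -> e != e2 -> col' e = col e) -> P y ->
    (forall x, P x -> x != y -> ~~ touches e1 u v x && ~~ touches e2 u v x) ->
    pair_potential col' u v = local_weight col' u v y * prodC (predC1 y).
  move=> eq_col Py un; rewrite /pair_potential (bigD1 y) //=; congr (_ * _).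
  apply: eq_bigr => x /andP[Px xy]; have /andP[n1 n2] := un x Px xy.
  exact: local_weight_untouched eq_col n1 n2.
(* Each edge touches at most one centre: either both edges do (the same centre or different ones),
   or just one of them, or neither. *)
case: t1P => [x1 /andP[P1 t1]|n1]; case: t2P => [x2 /andP[P2 t2]|n2].
- have [x12|x12] := eqVneq x1 x2.
    (* The ordering of the two sums says that the favoured edge is [x1 u]. *)
    subst x2.
    have un x : P x -> x != x1 -> ~~ touches e1 u v x && ~~ touches e2 u v x.
      move=> Px xx1; rewrite -negb_or; apply: contraNN xx1.
      by case/orP=> tx; apply/eqP; [apply: (uniq e1) | apply: (uniq e2)].
    have [x1u x1v] : x1 != u /\ x1 != v.
      by apply/andP; rewrite -negb_or; move: P1; rewrite /P !inE.
    have sumE w : x1 != w -> (\sum_(i in [set x1; w]) i = x1 + w)%N.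
      by move=> x1w; rewrite big_setU1 ?inE // big_set1.
    have [e1E e2E] : e1 = [set x1; u] /\ e2 = [set x1; v].
      case/orP: t1 => /eqP t1; case/orP: t2 => /eqP t2; try by [].
      - by rewrite t1 t2 eqxx in e12.
      - by move: le_e; rewrite t1 t2 !sumE // leq_add2l leqNgt lt_uv.
      - by rewrite t1 t2 eqxx in e12.
    rewrite !(split1 x1) // /local_weight -e1E -e2E c1 c2 col11 col12 col21 col22.
    by apply: scale => //; exact: weight_pair_step.
  have un1 : ~~ touches e2 u v x1.
    by apply: contraNN x12 => t; apply/eqP; apply: (uniq e2).
  have un2 : ~~ touches e1 u v x2.
    by apply: contraNN x12 => t; apply/eqP; apply: (uniq e1).
  have split2 col' : (forall e, e != e1 -> e != e2 -> col' e = col e) ->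
    pair_potential col' u v =
      (local_weight col' u v x1 * local_weight col' u v x2)
        * prodC [pred x | (x != x1) && (x != x2)].
    move=> eq_col; rewrite /pair_potential (bigD1 x1) //= (bigD1 x2) /=; last first.
      by apply/andP; split; [exact: P2 | rewrite eq_sym].
    rewrite mulrA; congr (_ * _); apply: eq_big => x.
      by rewrite /= -andbA.
    move=> /andP[/andP[Px xx1] xx2]; apply: (local_weight_untouched eq_col).
      by apply: contraNN xx1 => t; apply/eqP; apply: (uniq e1).
    by apply: contraNN xx2 => t; apply/eqP; apply: (uniq e2).
  have [b [c bc]] := local_weight_touched col uv P1 t1 un1.
  have [b' [c' bc']] := local_weight_touched col uv P2 t2 un2.
  rewrite !split2 // !bc // !bc'; try exact: swap.
  rewrite c1 c2 col11 col12 col21 col22.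
  by apply: scale => //; exact: slot_weight_step2.
- have un x : P x -> x != x1 -> ~~ touches e1 u v x && ~~ touches e2 u v x.
    move=> Px xx1; have := n2 x; rewrite Px /= => ->; rewrite andbT.
    by apply: contraNN xx1 => t; apply/eqP; apply: (uniq e1).
  have un1 : ~~ touches e2 u v x1 by have := n2 x1; rewrite P1 /= => ->.
  have [b [c bc]] := local_weight_touched col uv P1 t1 un1.
  rewrite !(split1 x1) // !bc // c1 col11 col21.
  by apply: scale => //; exact: (slot_weight_step K b c true).
- have un x : P x -> x != x2 -> ~~ touches e1 u v x && ~~ touches e2 u v x.
    move=> Px xx2; have := n1 x; rewrite Px /= => -> /=.
    by apply: contraNN xx2 => t; apply/eqP; apply: (uniq e2).
  have un2 : ~~ touches e1 u v x2 by have := n1 x2; rewrite P2 /= => ->.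
  have [b [c bc]] := local_weight_touched col uv P2 t2 un2.
  rewrite !(split1 x2) // !bc; try exact: swap.
  rewrite c2 col12 col22.
  by apply: scale => //; exact: (slot_weight_step K b c false).
have un col' : (forall e, e != e1 -> e != e2 -> col' e = col e) ->
    pair_potential col' u v = pair_potential col u v.
  move=> eq_col; apply: eq_bigr => x; rewrite -/(P x) => Px.
  apply: (local_weight_untouched eq_col).
    by have := n1 x; rewrite Px /= => ->.
  by have := n2 x; rewrite Px /= => ->.
by rewrite !un // -mulrDl; lra.
Qed.

End PairPotential.

(** * Derandomization: the potential and the greedy strategy *)

Section Client.
Variables (K : realFieldType) (n : nat).
Implicit Types (R B : {set {set 'I_n}}) (e : {set 'I_n}) (u v x : 'I_n).

Definition color R B e : option bool :=
  if e \in R then Some true else if e \in B then Some false else None.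

Definition potential R B : K :=
  \sum_(p : 'I_n * 'I_n | (p.1 < p.2)%N) pair_potential K (color R B) p.1 p.2.

Lemma color_recolor R B e1 e2 : e1 != e2 -> e2 \notin R ->
  color (e1 |: R) (e2 |: B) =1 recolor (color R B) e1 e2.
Proof.
move=> e12 e2R e; rewrite /color /recolor !inE.
have [->//|ne1] := eqVneq e e1.
by have [->|//] := eqVneq e e2; rewrite (negPf e2R).
Qed.

Lemma pair_potential_color R B e1 e2 u v : e1 != e2 -> e2 \notin R ->
  pair_potential K (color (e1 |: R) (e2 |: B)) u v =
  pair_potential K (recolor (color R B) e1 e2) u v.
Proof.
move=> e12 e2R; apply: eq_bigr => x _.
by rewrite /local_weight !color_recolor.
Qed.

(** The average of the two outcomes with odds 21:19 does not exceed the current potential, so one of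
    the outcomes does not either. *)
Lemma potential_step R B e1 e2 :
  e1 \notin R :|: B -> e2 \notin R :|: B -> e1 != e2 ->
  (potential (e1 |: R) (e2 |: B) <= potential R B) ||
  (potential (e2 |: R) (e1 |: B) <= potential R B).
Proof.
wlog le_e : e1 e2 / (\sum_(i in e1) i <= \sum_(i in e2) i)%N => [hwlog|].
  move=> f1 f2 e12; case/orP: (leq_total (\sum_(i in e1) i) (\sum_(i in e2) i)).
    by move/hwlog; apply.
  by rewrite orbC eq_sym in e12 *; move/hwlog; apply.
rewrite !inE !negb_or => /andP[e1R e1B] /andP[e2R e2B] e12.
have col e : e \notin R -> e \notin B -> color R B e = None.
  by rewrite /color => /negPf-> /negPf->.
have e21 : e2 != e1 by rewrite eq_sym.
have avg : 21 * potential (e1 |: R) (e2 |: B) + 19 * potential (e2 |: R) (e1 |: B)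
    <= 40 * potential R B.
  rewrite /potential !mulr_sumr -big_split; apply: ler_sum => -[u v] /= lt_uv.
  rewrite !pair_potential_color //.
  by apply: pair_potential_step; rewrite ?col.
by apply/orP; case: leP; [left | right; lra].
Qed.

(** The biased coin enters only the analysis: whenever keeping [e1] would raise the potential,
    [potential_step] ensures that keeping [e2] does not. *)
Definition greedy_client : client_strategy n :=
  fun R B e1 e2 => potential (e1 |: R) (e2 |: B) <= potential R B.

Lemma greedy_client_wins T :
  (forall R B, potential R B <= potential set0 set0 -> ~~ contains_copy T R) ->
  client_wins T.
Proof.
move=> no_copy; exists greedy_client.
suff wins k R B : potential R B <= potential set0 set0 ->
  strategy_wins T greedy_client k R B by exact: wins.
elim: k R B => [|k IHk] R B le_pot /=; first exact: no_copy le_pot.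
case: ifP => _; first exact: no_copy le_pot.
apply/forallP=> e1; apply/forallP=> e2; apply/implyP=> /and3P[].
rewrite inE => /andP[f1 _]; rewrite inE => /andP[f2 _] e12.
have := potential_step f1 f2 e12; rewrite /greedy_client.
by case: ifP => [le1 _|_ le2]; apply: IHk; apply: le_trans le_pot.
Qed.

Lemma potential0_le : potential set0 set0 <= (n * n)%:R.
Proof.
rewrite /potential (eq_bigr (fun=> 1)) => [|p _].
  rewrite sumr_const ler_nat -[n in (n * n)%N]card_ord -card_prod.
  exact: max_card.
by apply: big1 => x _; rewrite /local_weight /color !inE.
Qed.

Lemma pair_potential_le R B u v :
  (u < v)%N -> pair_potential K (color R B) u v <= potential R B.
Proof.
move=> lt_uv; rewrite /potential (bigD1 (u, v)) //= lerDl.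
by apply: sumr_ge0 => p _; apply/ltW/pair_potential_gt0.
Qed.

(** A centre with a red edge to [u] weighs at least 1961/2000, one with a red edge to [v] at least
    2041/2000, whatever its other edge; 188/200 is the least weight of all and bounds the remaining
    centres. *)
Lemma pair_potential_hubs R B u v (U V : {set 'I_n}) k :
  u != v -> U \subset ~: [set u; v] -> V \subset ~: [set u; v] ->
  [disjoint U & V] -> #|U| = k -> #|V| = k ->
  (forall x, x \in U -> [set x; u] \in R) ->
  (forall x, x \in V -> [set x; v] \in R) ->
  (1961 / 2000 * (2041 / 2000)) ^+ k * (188 / 200) ^+ (n - 2 - k - k)
    <= pair_potential K (color R B) u v.
Proof.
move=> uv sU sV dUV cU cV redU redV.
pose c x : K := if x \in U then 1961 / 2000 else
                if x \in V then 2041 / 2000 else 188 / 200.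
have -> : (1961 / 2000 * (2041 / 2000)) ^+ k * (188 / 200) ^+ (n - 2 - k - k) =
    \prod_(x in ~: [set u; v]) c x.
  rewrite (big_setID U) [X in _ = _ * X](big_setID V) /=.
  have -> : ~: [set u; v] :&: U = U by apply/setIidPr.
  have -> : (~: [set u; v] :\: U) :&: V = V.
    by apply/setIidPr; rewrite subsetD sV disjoint_sym.
  rewrite [X in _ = X * _](eq_bigr (fun=> 1961 / 2000)) => [|x xU]; last by rewrite /c xU.
  rewrite [X in _ = _ * (X * _)](eq_bigr (fun=> 2041 / 2000)) => [|x xV]; last first.
    by rewrite /c xV (disjointFl dUV xV).
  rewrite [X in _ = _ * (_ * X)](eq_bigr (fun=> 188 / 200)) => [|x]; last first.
    by rewrite /c !inE => /andP[/negPf-> /andP[/negPf-> _]].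
  rewrite !prodr_const cU cV exprMn -mulrA; congr (_ * (_ * _ ^+ _)).
  rewrite !cardsD (setIidPr sU).
  have -> : (~: [set u; v] :\: U) :&: V = V.
    by apply/setIidPr; rewrite subsetD sV disjoint_sym.
  by rewrite cU cV cardsCs setCK cards2 uv card_ord.
rewrite [X in X <= _](eq_bigl (fun x => x \notin [set u; v])) => [|x]; last first.
  by rewrite inE.
apply: ler_prod => x _; rewrite /c /local_weight /color.
case: ifP => [/redU->|_].
  by apply/andP; split; [lra | case: ifP => _; [|case: ifP => _] => /=; lra].
case: ifP => [/redV->|_].
  by apply/andP; split; [lra | case: ifP => _; [|case: ifP => _] => /=; lra].
apply/andP; split; first lra.
by case: ifP => _; [|case: ifP => _]; (case: ifP => _; [|case: ifP => _]) => /=; lra.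
Qed.

End Client.

(** * The three-hub tree and the potential forced by a copy of it *)

Lemma bernoulli (K : realFieldType) (t : K) m : 0 <= t -> 1 + t *+ m <= (1 + t) ^+ m.
Proof.
move=> t_ge0; elim: m => [|m IHm]; first by rewrite mulr0n addr0 expr0.
rewrite exprS; apply: le_trans (ler_wpM2l _ IHm); last lra.
have : 0 <= t * (t *+ m) by rewrite mulr_ge0 // mulrn_wge0.
by rewrite mulrSr; lra.
Qed.

(* Vertices 0, 1, 2 are hubs, with 1 and 2 attached to 0; then come [k] leaves
   of 0, [k] leaves of 1, and all remaining vertices are leaves of 2. *)
Definition broom_parent k i : nat :=
  if (i < k + 3)%N then 0 else if (i < k + k + 3)%N then 1 else 2.

Lemma broom_parent_lt k i : (0 < i -> broom_parent k i < i)%N.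
Proof. rewrite /broom_parent; do 2?case: ifP; lia. Qed.

(** The big hubs together fall about [n / 1000] leaves short of [n]. Subtracting 3 makes room for
    the hubs and cancels the [+ 3] of the degree bound. *)
Definition leaf_count n : nat := (n - n %/ 1000)./2 - 3.

Definition broom n : rel 'I_n := @parent_rel n (broom_parent (leaf_count n)).

Lemma max_degree_broom n : (5000 <= n)%N ->
  (max_degree (@broom n) <= leaf_count n + 3)%N.
Proof.
move=> n_ge; apply/bigmax_leqP => v _; rewrite /broom; set k := leaf_count n.
have [k3 [kn nk]] : (0 < k /\ k + k + 3 <= n /\ n - (k + k + 3) <= k)%N.
  by rewrite /k /leaf_count; lia.
have n_gt2 : (2 < n)%N by lia.
have nbr c lo hi : (hi <= n)%N -> (hi - lo <= k + 2)%N ->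
    (forall w : 'I_n, parent_rel (broom_parent k) v w ->
       (w == c) || (lo <= w < hi)%N) ->
    (degree (parent_rel (broom_parent k)) v <= k + 3)%N.
  by move=> h1 h2 h3; apply: leq_trans (degree_parent_rel h1 h3) _; lia.
have childE w : parent_rel (broom_parent k) v w ->
    (0 < v)%N && (w == broom_parent k v :> nat) ||
    (0 < w)%N && (v == broom_parent k w :> nat) by [].
have lt_pv : (broom_parent k v < n)%N.
  by rewrite /broom_parent; do 2?case: ifP; lia.
have [v_lt|v_ge] := ltnP v 3; last first.
  apply: (nbr (Ordinal lt_pv) 0 0) => // w /childE/orP[/andP[_ wE]|/andP[_ /eqP]].
    by apply/orP; left.
  by rewrite /broom_parent; do 2?case: ifP; lia.
pose lo := if v == 0 :> nat then 1 else if v == 1 :> nat then k + 3 else k + k + 3.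
pose hi := if v == 0 :> nat then k + 3 else if v == 1 :> nat then k + k + 3 else n.
apply: (nbr (Ordinal lt_pv) lo hi).
- by rewrite /hi; do 2?case: ifP; lia.
- by rewrite /hi /lo; do 2?case: ifP; lia.
move=> w /childE/orP[/andP[_ wE]|/andP[w_gt0 /eqP vE]]; apply/orP; [by left | right].
have := ltn_ord w; move: vE; rewrite /lo /hi /broom_parent.
by case: ifP => [?|?]; [|case: ifP => [?|?]] => -> /=; lia.
Qed.

(** Here [j] counts the centres outside both leaf sets. Each of them can be charged to 200 leaves of
    each big hub, and [i] is about a third of [n / 1000], so that an exponent [j] contains three
    exponents [i]. *)
Lemma leaf_count_bounds n M : (3000 * M + 5000 <= n)%N ->
  let k := leaf_count n in let j := (n - 2 - k - k)%N in
  let i := (n %/ 1000 %/ 3)%N in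
  [/\ 200 * j <= k, i * 3 <= j, M <= i.+1 & n <= 3000 * i.+1]%N.
Proof.
rewrite /leaf_count /= => le_n.
move: (divn_eq n 1000) (ltn_mod n 1000); set q := (n %/ 1000)%N => n_eq r_lt.
move: (divn_eq q 3) (ltn_mod q 3); set i := (q %/ 3)%N => q_eq s_lt.
move: (odd_double_half (n - q)); set h := (_./2)%N => h_eq.
by split; lia.
Qed.

(** Each loss of 188/200 is repaid by 200 gains of at least 1 + 3/5000, leaving a net factor of at
    least 21/20 for each of the [j] centres. This is exponential in [n] and beats [n * n]. *)
Lemma growth (K : archiRealFieldType) : exists n0, forall n, (n0 <= n)%N ->
  (n * n)%:R < (1961 / 2000 * (2041 / 2000)) ^+ leaf_count n *
    (188 / 200) ^+ (n - 2 - leaf_count n - leaf_count n) :> K.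
Proof.
(* Bernoulli: 1 + 200 * 3/5000 = 28/25. *)
have [N le_N bern] : exists2 N, (N <= 200)%N & 28 / 25 <= (1 + 3 / 5000) ^+ N :> K.
  by exists 200 => //; apply: le_trans (bernoulli 200 _); [rewrite -mulr_natr; lra | lra].
have [ab_ge rz_ge s_le1] : [/\ 1 + 3 / 5000 <= 1961 / 2000 * (2041 / 2000) :> K,
    1 + 1 / 20 <= 28 / 25 * (188 / 200) :> K & 1 / 20 <= 1 :> K].
  by clear; split; lra.
have [z_ge0 r_ge0 a_ge0 s_gt0] :
    [/\ 0 <= 188 / 200 :> K, 0 <= 28 / 25 :> K, 0 <= 3 / 5000 :> K & 0 < 1 / 20 :> K].
  by clear; split; lra.
move: (1961 / 2000 * _) (3 / 5000) (188 / 200) (28 / 25) (1 / 20)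
  bern ab_ge z_ge0 rz_ge r_ge0 a_ge0 s_gt0 s_le1 => ab a z r s.
move=> bern ab_ge z_ge0 rz_ge r_ge0 a_ge0 s_gt0 s_le1.
have a1_ge0 : 0 <= 1 + a by rewrite addr_ge0.
have s1_ge1 : 1 <= 1 + s by rewrite lerDl ltW.
have s1_ge0 := le_trans ler01 s1_ge1.
have ab_ge1 : 1 <= ab by apply: le_trans ab_ge; rewrite lerDl.
have ab_ge0 := le_trans ler01 ab_ge1.
(* As soon as [t >= M], this choice makes [(s * t) ^+ 3] exceed [(3000 * t) ^+ 2]. *)
pose M := Num.bound (3000 ^+ 2 / s ^+ 3).
exists (3000 * M + 5000)%N => n le_n; set k := leaf_count n.
set j := (n - 2 - k - k)%N; set i := (n %/ 1000 %/ 3)%N.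
have [jk ij iM ni] := leaf_count_bounds le_n; rewrite -/k -/j -/i in jk ij iM ni.
have kj : (N * j <= k)%N by apply: leq_trans jk; rewrite leq_mul2r le_N orbT.
have powk : r ^+ j <= ab ^+ k.
  apply: le_trans (ler_weXn2l ab_ge1 kj); rewrite exprM.
  apply: lerXn2r; rewrite ?nnegrE ?exprn_ge0 //.
  by apply: le_trans bern _; apply: lerXn2r.
apply: lt_le_trans (ler_wpM2r (exprn_ge0 j z_ge0) powk).
rewrite -exprMn.
apply: (@lt_le_trans _ _ ((1 + s) ^+ j)); last first.
  by apply: lerXn2r; rewrite ?nnegrE ?mulr_ge0.
(* Bernoulli alone is only linear; cubing the bound for exponent [i] gives cubic growth, enough
   against a square. *)
apply: lt_le_trans (ler_weXn2l s1_ge1 ij); rewrite exprM.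
set t : K := i.+1%:R.
have t_gt0 : 0 < t by rewrite ltr0n.
have le_t : s * t <= (1 + s) ^+ i.
  apply: (@le_trans _ _ (1 + s *+ i)); last exact: bernoulli (ltW s_gt0).
  rewrite /t -natr1 mulrDr mulr1 mulr_natr addrC lerD2r.
  exact: s_le1.
apply: (@lt_le_trans _ _ ((s * t) ^+ 3)); last first.
  by apply: lerXn2r; rewrite ?nnegrE ?exprn_ge0 // mulr_ge0 // ltW.
apply: (@le_lt_trans _ _ ((3000 * t) ^+ 2)).
  rewrite natrM -expr2; apply: lerXn2r; rewrite ?nnegrE ?ler0n //.
    by rewrite mulr_ge0 // ltW.
  by rewrite /t -natrM ler_nat.
rewrite [X in X < _]exprMn [X in _ < X]exprMn [t ^+ 3]exprS [X in _ < X]mulrA.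
rewrite ltr_pM2r ?exprn_gt0 // mulrC -ltr_pdivrMr ?exprn_gt0 //.
apply: (@lt_le_trans _ _ M%:R); last by rewrite ler_nat.
by apply: archi_boundP; rewrite divr_ge0 ?exprn_ge0 // ltW.
Qed.

(** The leaves of hubs 0 and 1 are mapped to disjoint red neighbourhoods of size [k], as
    [pair_potential_hubs] requires. *)
Lemma broom_copy_potential (K : realFieldType) n k (R B : {set {set 'I_n}}) :
  (k + k + 3 <= n)%N -> contains_copy (parent_rel (broom_parent k)) R ->
  (1961 / 2000 * (2041 / 2000)) ^+ k * (188 / 200) ^+ (n - 2 - k - k)
    <= potential K R B.
Proof.
move=> kn /existsP[f /andP[/injectiveP f_inj /forallP copy]].
have [n_gt0 n_gt1] : (0 < n /\ 1 < n)%N by lia.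
pose u := Ordinal n_gt0; pose v := Ordinal n_gt1.
pose U := [set i : 'I_n | (3 <= i < k + 3)%N].
pose V := [set i : 'I_n | (k + 3 <= i < k + k + 3)%N].
have edge x y : parent_rel (broom_parent k) x y -> [set f x; f y] \in R.
  by move/forallP: (copy x) => /(_ y)/implyP.
have uv : f u != f v by rewrite (inj_eq f_inj).
have sub_imset (W : {set 'I_n}) : (forall i, i \in W -> (1 < i)%N) ->
    f @: W \subset ~: [set f u; f v].
  move=> W_gt1; apply/subsetP=> _ /imsetP[i iW ->]; have := W_gt1 i iW.
  rewrite !inE !(inj_eq f_inj) negb_or => i_gt1.
  by apply/andP; split; apply: contraTneq i_gt1 => ->.
have sU : f @: U \subset ~: [set f u; f v].
  by apply: sub_imset => i; rewrite inE; lia.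
have sV : f @: V \subset ~: [set f u; f v].
  by apply: sub_imset => i; rewrite inE; lia.
have dUV : [disjoint f @: U & f @: V].
  rewrite imset_disjoint //.
  by apply/pred0P=> i /=; rewrite !inE; lia.
have cU : #|f @: U| = k by rewrite card_imset // card_ord_itv ?addnK ?addKn //; lia.
have cV : #|f @: V| = k by rewrite card_imset // card_ord_itv ?addnK ?addKn //; lia.
have redU x : x \in f @: U -> [set x; f u] \in R.
  case/imsetP=> i; rewrite inE => /andP[i_ge i_lt] ->; apply: edge.
  by rewrite /parent_rel /broom_parent i_lt /= andbT; lia.
have redV x : x \in f @: V -> [set x; f v] \in R.
  case/imsetP=> i; rewrite inE => /andP[i_ge i_lt] ->; apply: edge.
  rewrite /parent_rel /broom_parent i_lt /= [(i < k + 3)%N]ltnNge i_ge /= andbT.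
  lia.
(* The potential only contains increasing pairs. If the copy reverses the hubs, the leaf sets trade
   roles; having equal sizes, they give the same bound. *)
have [lt_uv|lt_vu|/val_inj eq_uv] := ltngtP (f u) (f v).
- apply: le_trans (pair_potential_le K R B lt_uv).
  exact: (pair_potential_hubs K B uv sU sV dUV cU cV redU redV).
- apply: le_trans (pair_potential_le K R B lt_vu).
  apply: (@pair_potential_hubs K n R B _ _ (f @: V) (f @: U)) => //.
  + by rewrite eq_sym.
  + by rewrite setUC.
  + by rewrite setUC.
  + by rewrite disjoint_sym.
- by rewrite eq_uv eqxx in uv.
Qed.

Theorem theorem1p3 (R : realType) :
  exists (c : R) (n0 : nat), 0 < c /\ (0 < n0)%N /\
    forall n : nat, (n0 <= n)%N ->
      exists T : rel 'I_n,
        is_tree T /\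
        ((max_degree T)%:R < (2^-1 - c) * n%:R) /\
        client_wins T.
Proof.
have [n0 big] := growth R.
(* The maximum degree is at most about 999n/2000, below (1/2 - 1/5000)n = 2499n/5000; [n >= 5000]
   absorbs the rounding. *)
exists (1 / 5000), (n0 + 5000)%N; split; [lra | split; [by lia |]].
move=> n le_n; have n_ge : (5000 <= n)%N by lia.
exists (@broom n); split; [|split].
- by apply: parent_rel_tree; [exact: broom_parent_lt | lia].
- have le_deg := max_degree_broom n_ge.
  have : (max_degree (@broom n) * 5000 < 2499 * n)%N.
    by move: le_deg; rewrite /leaf_count; lia.
  by rewrite -(ltr_nat R) !natrM; lra.
apply: (@greedy_client_wins R) => E B.
have {}big := big n (leq_trans (leq_addr _ _) le_n).
apply: contraL => copy; rewrite -ltNge.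
apply: le_lt_trans (potential0_le R n) (lt_le_trans big _).
by apply: broom_copy_potential copy; rewrite /leaf_count; lia.
Qed.
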